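(* Let $X$ be a well-filtered space for which the Scott power space $\Sigma\,\mathsf{K}(X)$ is first-countable or core-compact (especially, locally compact). Then $\Sigma\,\mathsf{K}(X)$ is sober.
   Context: A subset of a $T_0$ space $X$ is saturated if it equals the intersection of all open sets containing it. $\mathsf{K}(X)$ denotes the set of all nonempty compact saturated subsets of $X$, ordered by the Smyth order $K_1\sqsubseteq K_2 \iff K_2\subseteq K_1$. For a poset $P$, a subset $U$ is Scott open if $U$ is an upper set and for every (nonempty) directed $D\subseteq P$ whose supremum $\bigvee D$ exists in $P$, $\bigvee D\in U$ implies $D\cap U\neq\emptyset$; these sets form the Scott topology $\sigma(P)$, and $\Sigma P=(P,\sigma(P))$. The Scott power space of $X$ is $\Sigma\,\mathsf{K}(X)=(\mathsf{K}(X),\sigma(\mathsf{K}(X)))$. A $T_0$ space $X$ is well-filtered if for every filtered family $\mathcal K\subseteq \mathsf{K}(X)$ (nonempty, any two members contain a common third member) and every open $U$, $\bigcap\mathcal K\subseteq U$ implies $K\subseteq U$ for some $K\in\mathcal K$. A space is core-compact if its lattice of open sets is a continuous lattice, and locally compact if every neighborhood of every point contains a compact neighborhood of that point. A space is sober if every irreducible closed subset is the closure of a unique point. *)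

(* Defs.v *)
From HB Require Import structures.
From mathcomp Require Import all_boot all_order.
From mathcomp Require Import all_classical.
From mathcomp Require Import topology.
Set Implicit Arguments.
Unset Strict Implicit.
Unset Printing Implicit Defensive.
Import Order.TTheory.
Local Open Scope classical_set_scope.

Section posets.
Context {d : Order.disp_t} {P : porderType d}.
Implicit Types (U D : set P) (x y s : P).

Definition upper_set U := forall x y, U x -> (x <= y)%O -> U y.

Definition directed D :=
  D !=set0 /\
  forall x y, D x -> D y -> exists z, [/\ D z, (x <= z)%O & (y <= z)%O].

Definition scott_open U :=
  upper_set U /\
  forall D s, directed D -> isLub D s -> U s -> D `&` U !=set0.

Definition way_below x y :=
  forall D s, directed D -> isLub D s -> (y <= s)%O ->
  exists2 z, D z & (x <= z)%O.

Lemma scott_openT : scott_open setT.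
Proof. by split=> // D s [[x Dx] _] _ _; exists x. Qed.

Lemma scott_openI : setI_closed scott_open.
Proof.
move=> U V [upU iU] [upV iV]; split.
  by move=> x y [Ux Vx] xy; split; [exact: upU xy|exact: upV xy].
move=> D s dD sD [Us Vs].
have [x [Dx Ux]] := iU D s dD sD Us.
have [y [Dy Vy]] := iV D s dD sD Vs.
have [z [Dz xz yz]] := dD.2 x y Dx Dy.
by exists z; split=> //; split; [exact: upU xz|exact: upV yz].
Qed.

Lemma scott_open_bigU (I : Type) (f : I -> set P) :
  (forall i, scott_open (f i)) -> scott_open (\bigcup_i f i).
Proof.
move=> of_; split.
  by move=> x y [i _ fx] xy; exists i => //; exact: (of_ i).1 xy.
move=> D s dD sD [i _ fs]; have [x [Dx fx]] := (of_ i).2 D s dD sD fs.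
by exists x; split=> //; exists i.
Qed.

End posets.

Definition complete_lattice d (P : porderType d) :=
  forall A : set P, exists s, isLub A s.

Definition continuous_poset d (P : porderType d) :=
  forall x : P,
    directed [set y | way_below y x] /\ isLub [set y | way_below y x] x.

Definition continuous_lattice d (P : porderType d) :=
  complete_lattice P /\ continuous_poset P.

Definition scott_space d (P : porderType d) : Type := P.

HB.instance Definition _ d (P : porderType d) := Choice.on (scott_space P).
HB.instance Definition _ d (P : porderType d) :=
  isOpenTopological.Build (scott_space P)
    (@scott_openT d P) (@scott_openI d P) (@scott_open_bigU d P).

Lemma scott_spaceE d (P : porderType d) :
  @open (scott_space P) = @scott_open d P.
Proof. by []. Qed.

Section opens.
Variable X : topologicalType.

Record opens := Opens { opens_set :> set X; opens_open : open opens_set }.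

HB.instance Definition _ := gen_eqMixin opens.
HB.instance Definition _ := gen_choiceMixin opens.

Lemma opens_inj : injective opens_set.
Proof.
by case=> U oU [V oV] /= UV; case: _ / UV oV => oV; congr Opens; exact: Prop_irrelevance.
Qed.

Definition opens_le (U V : opens) : bool := `[< U `<=` V >].

Lemma opens_le_refl : reflexive opens_le.
Proof. by move=> U; apply/asboolP. Qed.

Lemma opens_le_anti : antisymmetric opens_le.
Proof.
move=> U V /andP[/asboolP UV /asboolP VU].
by apply: opens_inj; rewrite eqEsubset.
Qed.

Lemma opens_le_trans : transitive opens_le.
Proof.
by move=> V U W /asboolP UV /asboolP VW; apply/asboolP; exact: subset_trans VW.
Qed.

Fact opens_display : Order.disp_t. Proof. exact: Order.default_display. Qed.

HB.instance Definition _ :=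
  Order.Le_isPOrder.Build opens_display opens
    opens_le_refl opens_le_anti opens_le_trans.

End opens.

Section topological_notions.
Variable X : topologicalType.

Definition saturated (A : set X) :=
  A = \bigcap_(U in [set U : set X | open U /\ A `<=` U]) U.

Definition first_countable :=
  forall x : X, exists2 B : set (set X), countable B &
    B `<=` nbhs x /\ forall U, nbhs x U -> exists2 V, B V & V `<=` U.

Definition core_compact := continuous_lattice (opens X).

(* The library's [locally_compact] asks only for one closed compact
   neighbourhood of each point; without separation this is a different
   notion. *)
Definition locally_compact_space :=
  forall (x : X) (U : set X), nbhs x U ->
    exists V : set X, [/\ nbhs x V, compact V & V `<=` U].

Definition irreducible (A : set X) :=
  A !=set0 /\
  forall B C : set X, closed B -> closed C -> A `<=` B `|` C ->
    A `<=` B \/ A `<=` C.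

Definition sober :=
  forall A : set X, closed A -> irreducible A ->
    exists! x : X, A = closure [set x].

End topological_notions.

Section smyth.
Variable X : topologicalType.

Record compact_sat := CompactSat {
  compact_sat_set :> set X ;
  compact_sat_neq0 : compact_sat_set !=set0 ;
  compact_sat_compact : compact compact_sat_set ;
  compact_sat_saturated : saturated compact_sat_set }.

HB.instance Definition _ := gen_eqMixin compact_sat.
HB.instance Definition _ := gen_choiceMixin compact_sat.

Lemma compact_sat_inj : injective compact_sat_set.
Proof.
case=> K K0 cK sK [L L0 cL sL] /= KL.
case: _ / KL L0 cL sL => L0 cL sL.
by congr CompactSat; exact: Prop_irrelevance.
Qed.

Definition smyth_le (K L : compact_sat) : bool := `[< L `<=` K >].

Lemma smyth_le_refl : reflexive smyth_le.
Proof. by move=> K; apply/asboolP. Qed.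

Lemma smyth_le_anti : antisymmetric smyth_le.
Proof.
move=> K L /andP[/asboolP LK /asboolP KL].
by apply: compact_sat_inj; rewrite eqEsubset.
Qed.

Lemma smyth_le_trans : transitive smyth_le.
Proof.
by move=> L K M /asboolP LK /asboolP ML; apply/asboolP; exact: subset_trans LK.
Qed.

Fact smyth_display : Order.disp_t. Proof. exact: Order.default_display. Qed.

HB.instance Definition _ :=
  Order.Le_isPOrder.Build smyth_display compact_sat
    smyth_le_refl smyth_le_anti smyth_le_trans.

Definition filtered_family (F : set compact_sat) :=
  F !=set0 /\
  forall K L, F K -> F L -> exists M, [/\ F M, M `<=` K & M `<=` L].

Definition well_filtered :=
  kolmogorov_space X /\
  forall (F : set compact_sat) (U : set X), filtered_family F -> open U ->
    \bigcap_(K in F) (K : set X) `<=` U -> exists2 K, F K & K `<=` U.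

End smyth.

Notation scott_power_space X := (scott_space (compact_sat X)).

(* Main.v *)
Require Import Defs.
From mathcomp Require Import all_boot all_order all_classical topology.

(** The Scott power space of a well-filtered space X is itself well-filtered
    ([scott_power_space_well_filtered]), and a well-filtered space is sober as
    soon as it is first-countable
    ([first_countable_well_filtered_sober]), locally compact
    ([locally_compact_well_filtered_sober]) or core-compact (which reduces to
    local compactness by [core_compact_locally_compact]).

    A recurring tool is the Rudin-type lemma [rudin_maximal_open]: a closed set
    meeting every member of a suitable family contains a minimal one.  It is
    phrased by complements, as the existence of a maximal open set containing
    no member of the family; then an open W that meets the minimal closed set C
    contains the trace S `&` C of some member S.

    For the power space, let F be a filtered family of compact saturated sets
    of compact sets, and let C be a minimal Scott-closed set meeting every
    Q in F.  The unions B(Q) of the members of Q `&` C are compact saturated in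
    X and filtered, and each lies below some element of C, so their
    intersection S, which is their directed supremum, lies in C.  For x in S,
    the compact sets containing x form a closed set that meets every Q `&` C,
    so by minimality it contains C.  Hence every element of C lies below S, and
    S belongs to all Q in F.  This is a point of C in the intersection of F.

    The two passages to sobriety that are not formal use sequences x with the
    property that an open set containing one x_i contains all but finitely many
    x_k.  Their tails are compact, so well-filteredness yields a point, in any
    closed set containing the sequence, that belongs to every open set
    containing a tail ([well_filtered_limit]).  In a first-countable space this
    makes every irreducible closed set directed for the specialization order.
    In a core-compact space it shows that a sequence of open sets, each way
    below the preceding one, has a compact intersection, whence local
    compactness. *)

Set Implicit Arguments.
Unset Strict Implicit.
Unset Printing Implicit Defensive.
Import Order.TTheory.
Local Open Scope classical_set_scope.

(** * Relative compactness, saturation and Rudin's lemma *)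

Section compactness.
Variable Y : topologicalType.
Implicit Types (A C K M S T U V W : set Y).

Definition directed_opens (I : Type) (D : set I) (f : I -> set Y) :=
  [/\ D !=set0, forall i, D i -> open (f i) &
    forall i j, D i -> D j -> exists k, [/\ D k, f i `<=` f k & f j `<=` f k]].

(** The way-below relation of the lattice of open sets, extended to arbitrary
    subsets: it covers at once the pairs V << U of open sets and, on the
    diagonal, the compact sets. *)
Definition relatively_compact T S :=
  forall (I : Type) (D : set I) (f : I -> set Y), directed_opens D f ->
    S `<=` \bigcup_(i in D) f i -> exists2 i, D i & T `<=` f i.

(** If no f i covers K, the sets K minus f i generate a proper filter, whose
    cluster point contradicts that the f i cover K.  Conversely, if a filter on
    K has no cluster point in K, then the open sets disjoint from some member
    of the filter form a directed cover of K. *)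
Lemma compact_relatively K : compact K <-> relatively_compact K K.
Proof.
split=> [cK I D f [D0 fo fD] Kf|cK F PF FK].
- apply: contrapT => noi.
  have H i : D i -> (K `\` f i) !=set0.
    move=> Di; apply: contrapT => /nonemptyPn e; apply: noi; exists i => //.
    by apply/subsets_disjoint; rewrite -setDE.
  have FF : Filter (filter_from D (fun i => K `\` f i)).
    apply: filter_from_filter => // i j Di Dj.
    have [k [Dk ik jk]] := fD i j Di Dj.
    exists k => // x [Kx fx]; split; split=> // ?; apply: fx; [exact: ik|exact: jk].
  have PF := filter_from_proper FF H.
  have [|x [Kx xF]] := cK _ PF.
    by have [i Di] := D0; exists i => // y [].
  have [i Di fx] := Kf _ Kx.
  have [|z [[_ nz] fz]] := xF (K `\` f i) (f i) _ (open_nbhs_nbhs (conj (fo _ Di) fx)).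
    by exists i.
  by [].
- apply: contrapT => noc.
  pose D := [set W | open W /\ exists2 B, F B & W `&` B = set0].
  have [||W [Wo [B FB WB]] KW] := cK _ D id.
  + split.
    * exists set0; split; first exact: open0.
      by exists setT; [exact: filterT|rewrite set0I].
    * by move=> i [].
    * move=> U V [Uo [B FB UB]] [Vo [B' FB' VB']]; exists (U `|` V).
      split; [|exact: subsetUl|exact: subsetUr]; split; first exact: openU.
      exists (B `&` B'); first exact: filterI.
      rewrite -subset0 => x [[Ux|Vx] [Bx B'x]]; first by rewrite -UB.
      by rewrite -VB'.
  + move=> x Kx; apply: contrapT => nx; apply: noc; exists x; split=> //.
    move=> B V FB; rewrite nbhsE => -[V' [V'o V'x] V'V]; apply: contrapT => n.
    apply: nx; exists V' => //; split=> //; exists B => //.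
    by rewrite -subset0 => y [V'y By]; apply: n; exists y; split=> //; exact: V'V.
  + apply: (@filter_not_empty _ F PF); apply: filterS (filterI FK FB) => x [Kx Bx].
    by rewrite -WB; split=> //; exact: KW.
Qed.

Definition saturation A := \bigcap_(U in [set U | open U /\ A `<=` U]) U.

Lemma sub_saturation A : A `<=` saturation A.
Proof. by move=> x Ax U [_]; exact. Qed.

Lemma saturation_sub_open A U : open U -> A `<=` U -> saturation A `<=` U.
Proof. by move=> oU AU x; apply. Qed.

Lemma saturation_sub A C : C `<=` saturation A -> saturation C `<=` saturation A.
Proof. by move=> CA x Cx U [oU AU]; apply: Cx; split=> // y /CA; exact. Qed.

Lemma saturated_saturation A : saturated (saturation A).
Proof.
by apply/seteqP; split=> [|x]; [exact: sub_saturation|exact: saturation_sub].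
Qed.

Lemma compact_saturation K : compact K -> compact (saturation K).
Proof.
move=> /compact_relatively cK; apply/compact_relatively => I D f Df Kf.
have [i Di Ki] := cK _ _ _ Df (subset_trans (@sub_saturation _) Kf).
by exists i => //; apply: saturation_sub_open => //; case: Df => _ + _; exact.
Qed.

(** A point outside every f i is separated from each f i by an open set; the
    union of these open sets separates it from the union of the f i. *)
Lemma saturated_bigcup (I : Type) (D : set I) (f : I -> set Y) :
  (forall i, D i -> saturated (f i)) -> saturated (\bigcup_(i in D) f i).
Proof.
move=> sf; apply/seteqP; split=> [|x xf]; first exact: sub_saturation.
apply: contrapT => nx.
have sep i : exists V, D i -> [/\ open V, f i `<=` V & ~ V x].
  have [Di|nDi] := pselect (D i); last by exists setT.
  apply: contrapT => nV; apply: nx; exists i => //; rewrite (sf _ Di) => V [oV iV].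
  by apply: contrapT => nVx; apply: nV; exists V.
have /choice[V VP] := sep.
have [|i Di] := xf (\bigcup_(i in D) V i).
  split; first by apply: bigcup_open => i /VP[].
  by move=> y [i Di iy]; exists i => //; have [_ + _] := VP _ Di; apply.
by have [_ _] := VP _ Di.
Qed.

(** Topological Rudin lemma, for the complement M of a minimal closed set
    meeting all members of F.  Zorn's lemma applies because, if the union of a
    chain of open sets contained S, a member of the chain would contain some T
    in F that is relatively compact in S. *)
Lemma rudin_maximal_open (F : set (set Y)) U :
    (forall S, F S -> exists2 T, F T & relatively_compact T S) ->
    open U -> (forall S, F S -> ~ S `<=` U) ->
  exists M, [/\ open M, U `<=` M, forall S, F S -> ~ S `<=` M &
    forall W, open W -> ~ W `<=` M -> exists2 S, F S & S `<=` M `|` W].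
Proof.
move=> Fc oU FU.
(* U is kept inside the condition so that the empty chain satisfies it. *)
pose P W := open W /\ forall S, F S -> ~ S `<=` U `|` W.
have [G GP Gt|A [[oA FA] Amax]] := @Zorn_bigcup _ P.
  split; first by apply: bigcup_open => W /GP[].
  move=> S FS SG; have [W0|G0] := pselect (G !=set0); last first.
    by apply: (FU _ FS) => x /SG[//|[W GW _]]; case: G0; exists W.
  have [T FT TS] := Fc _ FS.
  have [||W GW TW] := TS _ G (fun W => U `|` W).
  - split=> //; first by move=> W /GP[oW _]; exact: openU.
    move=> V W GV GW; have [VW|WV] := Gt _ _ GV GW.
      by exists W; split=> //; exact: setUS.
    by exists V; split=> //; exact: setUS.
  - case: W0 => W0 GW0; move=> x /SG[Ux|[W GW Wx]].
      by exists W0 => //; left.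
    by exists W => //; right.
  - by case: (GP _ GW) => _ /(_ _ FT).
exists (U `|` A); split=> [||//|]; [exact: openU|by move=> x; left|].
move=> W oW nW; apply: contrapT => nS.
apply: (Amax (A `|` W)).
  split; first by move=> x; left.
  by move=> AW; apply: nW => x Wx; right; apply: AW; right.
split; first exact: openU.
by move=> S FS; rewrite setUA => SW; apply: nS; exists S.
Qed.

(** An open set containing x n misses only finitely many terms of the tail, so
    directedness absorbs them one at a time. *)
Lemma compact_tail (x : nat -> Y) n :
  (forall U i, open U -> U (x i) -> exists m, forall k, m <= k -> U (x k)) ->
  compact [set x k | k in [set k | n <= k]].
Proof.
move=> xx; apply/compact_relatively => I D f [D0 fo fD] xf.
have [i Di xi] : (\bigcup_(i in D) f i) (x n) by apply: xf; exists n => /=.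
have [m xm] := xx _ _ (fo _ Di) xi.
have [j [Dj ij xj]] : exists j, [/\ D j, f i `<=` f j &
    forall k, n <= k -> k < m -> f j (x k)].
  elim: m {xm} => [|m [j [Dj ij xj]]]; first by exists i; split.
  have [nm|mn] := leqP n m; last first.
    by exists j; split=> // k nk km; have := leq_ltn_trans nk km; rewrite ltnS leqNgt mn.
  have [l Dl xl] : (\bigcup_(i in D) f i) (x m) by apply: xf; exists m.
  have [p [Dp jp lp]] := fD _ _ Dj Dl.
  exists p; split=> // [y /ij/jp//|k nk].
  rewrite ltnS leq_eqVlt => /predU1P[->|km]; first exact: lp.
  by apply/jp/xj.
exists j => // y [k nk <-]; have [mk|km] := leqP m k; first by apply/ij/xm.
exact: xj.
Qed.

Lemma irreducible_meet A U V : irreducible A -> open U -> open V ->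
  U `&` A !=set0 -> V `&` A !=set0 -> (U `&` V) `&` A !=set0.
Proof.
move=> [_ irrA] oU oV [u [Uu Au]] [v [Vv Av]]; apply: contrapT => n.
have [|H|H] := irrA _ _ (open_closedC oU) (open_closedC oV).
- move=> a Aa; apply: contrapT => /not_orP[/contrapT Ua /contrapT Va].
  by apply: n; exists a.
- exact: H Au Uu.
- exact: H Av Vv.
Qed.

End compactness.

(** * Well-filtered spaces *)

Section well_filtered_spaces.
Variable Y : topologicalType.
Hypothesis wfY : well_filtered Y.
Implicit Types (A C K M S T U V W : set Y).

(** Contrapositive form of well-filteredness, for compact sets that need not be
    saturated: it is enough that the family is filtered up to saturation, so it
    applies to singletons ordered by specialization. *)
Lemma well_filtered_meet (I : Type) (D : set I) (K : I -> set Y) C :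
    D !=set0 -> (forall i, D i -> compact (K i)) ->
    (forall i j, D i -> D j -> exists k,
      [/\ D k, K k `<=` saturation (K i) & K k `<=` saturation (K j)]) ->
    closed C -> (forall i, D i -> K i `&` C !=set0) ->
  exists2 c, C c & forall i, D i -> saturation (K i) c.
Proof.
move=> [i0 Di0] cK fK cC KC.
pose F := [set L : compact_sat Y | exists2 i, D i & L = saturation (K i) :> set Y].
have FK i : D i -> exists2 L, F L & L = saturation (K i) :> set Y.
  move=> Di.
  have K0 : saturation (K i) !=set0.
    by have [x [Kx _]] := KC _ Di; exists x; exact: sub_saturation.
  by exists (CompactSat K0 (compact_saturation (cK _ Di))
               (@saturated_saturation _ (K i))) => //; exists i.
apply: contrapT => noc.
have [|||L [i Di Li] LC] := wfY.2 F (~` C).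
- split; first by have [L FL _] := FK _ Di0; exists L.
  move=> L N [i Di ->] [j Dj ->].
  have [k [Dk ki kj]] := fK _ _ Di Dj; have [M FM ME] := FK _ Dk.
  by exists M; split=> //; rewrite ME; exact: saturation_sub.
- exact: closed_openC.
- move=> x Fx Cx; apply: noc; exists x => // i Di.
  by have [L FL <-] := FK _ Di; exact: Fx.
- have [x [Kx Cx]] := KC _ Di; apply: (LC x) => //.
  by rewrite Li; exact: sub_saturation.
Qed.

(** The tails of such a sequence form a filtered family of compact sets meeting
    C. *)
Lemma well_filtered_limit (x : nat -> Y) C :
    (forall U i, open U -> U (x i) -> exists m, forall k, m <= k -> U (x k)) ->
    closed C -> (forall k, C (x k)) ->
  exists2 c, C c &
    forall U m, open U -> (forall k, m <= k -> U (x k)) -> U c.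
Proof.
move=> xx cC Cx.
have [||i j _ _||n _|c Cc xc] := @well_filtered_meet nat setT
    (fun n => [set x k | k in [set k | n <= k]]) C.
- by exists 0.
- by move=> n _; exact: compact_tail.
- exists (maxn i j); split=> // _ [k /= + <-]; rewrite geq_max => /andP[ik jk];
  by apply: sub_saturation; exists k.
- by [].
- by exists (x n); split=> //; exists n => /=.
exists c => // U m oU xU; apply: (xc m I); split=> // _ [k mk <-]; exact: xU.
Qed.

(** The condition on c says that A is contained in the closure of c; the T0
    axiom makes c unique. *)
Lemma generic_point A c : closed A -> A c ->
  (forall U, open U -> U `&` A !=set0 -> U c) ->
  exists! x, A = closure [set x].
Proof.
have cl (a b : Y) V : closure [set a] = closure [set b] -> nbhs a V -> V b.
  move=> ab aV; have : closure [set b] a by rewrite -ab; exact: subset_closure.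
  by move=> /(_ V aV)[_ [-> ]].
move=> cA Ac gA.
have Ac' : A = closure [set c].
  apply/seteqP; split=> [a Aa V|].
    rewrite nbhsE => -[U [oU Ua] UV]; exists c; split=> //; apply: UV.
    by apply: gA => //; exists a.
  by rewrite (closure_id A).1//; apply: closureS => _ ->.
exists c; split=> // y Ay; apply: contrapT => cy.
have E : closure [set c] = closure [set y] by rewrite -Ac'.
have [V [[/set_mem cV /set_mem]|[/set_mem yV /set_mem]]] := wfY.1 c y (introN eqP cy).
- by apply; exact: cl E cV.
- by apply; exact: cl (esym E) yV.
Qed.

(** The compact sets whose interior meets A are filtered, by irreducibility and
    local compactness.  A point of A in all of their saturations is generic,
    since each open set meeting A contains one of these compact sets. *)
Lemma locally_compact_well_filtered_sober :
  locally_compact_space Y -> sober Y.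
Proof.
move=> lc A cA irrA; have [[a0 Aa0] _] := irrA.
pose D := [set Q : set Y | compact Q /\ interior Q `&` A !=set0].
have mem a U : A a -> open U -> U a -> exists2 Q, D Q & Q `<=` U.
  move=> Aa oU Ua; have [Q [aQ cQ QU]] := lc a U (open_nbhs_nbhs (conj oU Ua)).
  by exists Q => //; split=> //; exists a.
have [|Q []//|Q R [cQ QA] [cR RA]|//|Q [_ [a [Qa Aa]]]|c Ac Dc] :=
  @well_filtered_meet _ D id A.
- by have [Q DQ _] := mem _ _ Aa0 openT I; exists Q.
- have [a [Ua Aa]] :=
    irreducible_meet irrA (open_interior Q) (open_interior R) QA RA.
  have [P DP PU] := mem _ _ Aa (openI (open_interior Q) (open_interior R)) Ua.
  exists P; split=> // x /PU[Qx Rx]; apply: sub_saturation; exact: interior_subset.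
- by exists a; split=> //; exact: interior_subset.
apply: (@generic_point _ c) => // U oU [a [Ua Aa]].
by have [Q DQ QU] := mem _ _ Aa oU Ua; exact: saturation_sub_open (Dc _ DQ).
Qed.

End well_filtered_spaces.

(** * Core-compact well-filtered spaces are locally compact *)

(** The elements with two way-below steps up to z form a directed set, and its
    supremum is still z; so x, being way below z, lies below one of them. *)
Lemma continuous_poset_interpolation d (P : porderType d) (x z : P) :
  continuous_poset P -> way_below x z ->
  exists2 y, way_below x y & way_below y z.
Proof.
have wb_le (a b c : P) : way_below a b -> (b <= c)%O -> way_below a c.
  by move=> ab bc D s dD sD cs; apply: ab dD sD (le_trans bc cs).
move=> cP xz; have [[[y0 y0z] dz] [zub zlub]] := cP z.
have [|||w [y wy yz] xw] := xz [set w | exists2 y, way_below w y & way_below y z] z.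
- split.
    by have [[[w wy] _] _] := cP y0; exists w, y0.
  move=> w w' [y wy yz] [y' wy' yz'].
  have [u [uz yu yu']] := dz _ _ yz yz'.
  have [[_ du] _] := cP u.
  have [v [vu wv wv']] := du _ _ (wb_le _ _ _ wy yu) (wb_le _ _ _ wy' yu').
  by exists v; split=> //; exists u.
- split.
    move=> w [y wy yz]; apply: le_trans (zub _ yz).
    by have [_ [yub _]] := cP y; exact: yub.
  move=> b bub; apply: zlub => y yz.
  by have [_ [_ ylub]] := cP y; apply: ylub => w wy; apply: bub; exists y.
- exact: lexx.
exists y => //; move=> D s dD sD ys; have [v Dv wv] := wy D s dD sD ys.
by exists v => //; exact: le_trans wv.
Qed.

Lemma way_below_relatively_compact (Y : topologicalType) (U V : opens Y) :
  way_below U V -> relatively_compact (U : set Y) V.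
Proof.
move=> UV I D f [[i0 Di0] fo fD] Vf.
have [|||W [i Di Wi] /asboolP UW] := UV
  [set W | exists2 i, D i & W = f i :> set Y] (Opens (bigcup_open fo)).
- split; first by exists (Opens (fo _ Di0)), i0.
  move=> A B [i Di Ai] [j Dj Bj]; have [k [Dk ik jk]] := fD _ _ Di Dj.
  exists (Opens (fo _ Dk)); split; first by exists k.
    by apply/asboolP; rewrite Ai.
  by apply/asboolP; rewrite Bj.
- split=> [A [i Di Ai]|B Bub].
    by apply/asboolP; rewrite Ai; exact: bigcup_sup.
  apply/asboolP => x [i Di fx].
  by have /asboolP := Bub (Opens (fo _ Di)) (ex_intro2 _ _ _ Di erefl); exact.
- exact/asboolP.
by exists i => //; rewrite -Wi.
Qed.

Section core_compact.
Variable Y : topologicalType.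
Hypothesis wfY : well_filtered Y.
Implicit Types (A C K M S T U V W : set Y).

(** Although the O n are not compact, they behave like a filtered family of
    compact sets.  If no O n lies in U, take M maximal open containing U but no
    O n, and points x n of O n outside M.  By maximality every open set
    containing one x i contains O m minus M for some m, hence a tail of x; a
    limit of x then lies in all O n but not in M. *)
Lemma well_filtered_relatively_compact_cap (O : nat -> set Y) U :
    (forall n, open (O n)) -> (forall n, O n.+1 `<=` O n) ->
    (forall n, relatively_compact (O n.+1) (O n)) ->
    open U -> \bigcap_n O n `<=` U ->
  exists n, O n `<=` U.
Proof.
move=> oO decr rO oU OU; apply: contrapT => nU.
have dec m n : m <= n -> O n `<=` O m.
  elim: n => [|n IH]; first by rewrite leqn0 => /eqP->.
  rewrite leq_eqVlt => /predU1P[->//|mn]; exact: subset_trans (IH mn).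
have [S [n _ <-]|//|S [n _ <-] OnU|M [oM UM OM Mmax]] :=
  @rudin_maximal_open _ (range O) U.
- by exists (O n.+1) => //; exists n.+1.
- by apply: nU; exists n.
have /choice[x xP] n : exists y, O n y /\ ~ M y.
  apply: contrapT => H; apply: (OM (O n)); first by exists n.
  by move=> y Oy; apply: contrapT => My; apply: H; exists y.
have [W i oW Wi||k|c Mc cP] := @well_filtered_limit _ wfY x (~` M).
- have [|S [m _ <-] OW] := Mmax W oW; first by move=> /(_ _ Wi); exact: (xP i).2.
  exists m => k mk; have [Ok nM] := xP k.
  by have [] := OW _ (dec _ _ mk _ Ok).
- exact: open_closedC.
- exact: (xP k).2.
apply/Mc/UM/OU => n _; apply: (cP _ n) => // k nk.
by apply: dec nk _ _; exact: (xP k).1.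
Qed.

(** Interpolating between V << U gives a sequence of open sets from U down, each
    way below the preceding one and all containing V.  Their intersection is a
    compact set between V and U. *)
Lemma core_compact_locally_compact : core_compact Y -> locally_compact_space Y.
Proof.
move=> [_ cY] y U0; rewrite nbhsE => -[U [oU Uy] UU0].
have [V VU Vy] : exists2 V : opens Y, way_below V (Opens oU) & (V : set Y) y.
  apply: contrapT => nV; have [_ [_ lubU]] := cY (Opens oU).
  have oB : open (\bigcup_(V in [set V : opens Y | way_below V (Opens oU)]) (V : set Y)).
    by apply: bigcup_open => V _; exact: opens_open.
  have /asboolP/(_ _ Uy)[V VU Vy] : (Opens oU <= Opens oB)%O.
    by apply: lubU => V VU; apply/asboolP => x Vx; exists V.
  by apply: nV; exists V.
have /choice[g gP] (W : opens Y) : exists W' : opens Y, way_below V W ->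
    way_below V W' /\ way_below W' W.
  have [VW|VW] := pselect (way_below V W); last by exists V.
  by have [W' VW' W'W] := continuous_poset_interpolation cY VW; exists W'.
pose O n := iter n g (Opens oU).
have VO n : way_below V (O n) by elim: n => //= n /gP[].
have OO n : way_below (O n.+1) (O n) by have [] := gP _ (VO n).
have wb_sub (A B : opens Y) : way_below A B -> (A : set Y) `<=` B.
  by move=> AB; apply/asboolP; have [_ [ub _]] := cY B; exact: ub.
exists (\bigcap_n (O n : set Y)); split.
- exists V; first by split=> //; exact: opens_open.
  by move=> x Vx n _; exact: wb_sub (VO n) _ Vx.
- apply/compact_relatively => I D f Df Of; have [_ fo _] := Df.
  have [|||||n On] := @well_filtered_relatively_compact_cap O (\bigcup_(i in D) f i).
  + by move=> n; exact: opens_open.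
  + by move=> n; exact: wb_sub.
  + by move=> n; exact: way_below_relatively_compact.
  + exact: bigcup_open.
  + exact: Of.
  have [i Di Oi] := way_below_relatively_compact (OO n) Df On.
  by exists i => // x Ox; apply: Oi; exact: Ox.
- by move=> x /(_ 0 I); exact: UU0.
Qed.

End core_compact.

(** * First-countable well-filtered spaces are sober *)

Lemma first_countable_open_base (Y : topologicalType) (x : Y) :
  first_countable Y ->
  exists W : nat -> set Y, [/\ forall n, open (W n), forall n, W n x &
    forall U, open U -> U x -> exists m, forall k, m <= k -> W k `<=` U].
Proof.
move=> /(_ x)[B cB [Bx Bbase]].
have [f fB] : exists f : nat -> set Y, B = range f.
  have [B0|[f]] := pfcard_geP cB.
    by have [V] := Bbase setT filterT; rewrite B0.
  by exists f; rewrite image_eq.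
have fx n : nbhs x (f n) by apply: Bx; rewrite fB; exists n.
pose W := fix W n := if n is m.+1 then W m `&` interior (f m) else setT.
exists W; split.
- by elim=> [|n IH] /=; [exact: openT|exact: openI IH (open_interior _)].
- by elim=> [|n IH] //=; split=> //; exact: fx.
- move=> U oU Ux; have [V] := Bbase _ (open_nbhs_nbhs (conj oU Ux)).
  rewrite fB => -[n _ <-] nU; exists n.+1.
  elim=> // k IH; rewrite ltnS leq_eqVlt => /predU1P[<- y [_ /interior_subset/nU]//|nk].
  by move=> y [Wy _]; exact: IH.
Qed.

(** Given a and b in A, irreducibility allows one to choose x n in A inside the
    n-th basic neighbourhoods of a, of b and of all earlier x i.  A limit of
    this sequence in A lies above a and b for the specialization order.  So A
    is directed, and well-filteredness applied to its singletons gives a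
    greatest element of A. *)
Lemma first_countable_well_filtered_sober (Y : topologicalType) :
  well_filtered Y -> first_countable Y -> sober Y.
Proof.
move=> wfY fcY A cA irrA; have [[a0 Aa0] _] := irrA.
have /choice[W WP] x := first_countable_open_base x fcY.
have dirA a b : A a -> A b -> exists c,
    [/\ A c, saturation [set a] c & saturation [set b] c].
  move=> Aa Ab.
  pose pick S := xget a (S `&` A).
  (* G n k is the intersection of the k-th basic neighbourhoods of a, of b and
     of the points chosen before step n; x n is chosen in the diagonal set
     G n n, so it lies in the n-th neighbourhood of every earlier point. *)
  pose G := fix G n := if n is m.+1 then fun k => G m k `&` W (pick (G m m)) k
                       else fun k => W a k `&` W b k.
  pose x n := pick (G n n).
  have oW y k : open (W y k) by have [] := WP y.
  have Wy y k : W y k y by have [] := WP y.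
  have oG n k : open (G n k) by elim: n => [|n IH] /=; exact: openI.
  have pickP S : S `&` A !=set0 -> (S `&` A) (pick S).
    by move=> [y Sy]; exact: xgetPex (ex_intro _ y Sy).
  have GA n k : G n k `&` A !=set0.
    elim: n k => [|n IH] k /=; apply: irreducible_meet => //.
    - by exists a.
    - by exists b.
    - by exists (pick (G n n)); split=> //; have [] := pickP _ (IH n).
  have xP n : G n n (x n) /\ A (x n) by have := pickP _ (GA n n).
  have GG m n k : m <= n -> G n k `<=` G m k.
    elim: n => [|n IH]; first by rewrite leqn0 => /eqP->.
    by rewrite leq_eqVlt => /predU1P[->//|mn] y [/(IH mn)].
  have base y U m : open U -> U y -> (forall k, m <= k -> W y k (x k)) ->
      exists l, forall k, l <= k -> U (x k).
    move=> oU Uy Wx; have [_ _ /(_ U oU Uy)[l lP]] := WP y.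
    exists (maxn l m) => k; rewrite geq_max => /andP[lk mk].
    by apply: lP lk _ _; exact: Wx.
  have [U i oU Uxi||k|c Ac cP] := @well_filtered_limit _ wfY x A.
  - apply: (base (x i) U i.+1) => // k ik.
    by have [xk _] := xP k; have [] := GG _ _ _ ik _ xk.
  - exact: cA.
  - exact: (xP k).2.
  have x0 k : W a k (x k) /\ W b k (x k).
    by have [xk _] := xP k; exact: GG (leq0n k) _ xk.
  exists c; split=> // U [oU /(_ _ erefl) Uy].
  + have [l lP] := base a U 0 oU Uy (fun k _ => (x0 k).1); exact: cP lP.
  + have [l lP] := base b U 0 oU Uy (fun k _ => (x0 k).2); exact: cP lP.
have [|a _|a b Aa Ab||a Aa|c Ac cP] :=
  @well_filtered_meet _ wfY _ A (fun a => [set a]) A.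
- by exists a0.
- exact: compact_set1.
- by have [c [Ac ac bc]] := dirA _ _ Aa Ab; exists c; split=> // _ ->.
- exact: cA.
- by exists a.
apply: (generic_point wfY cA Ac) => U oU [a [Ua Aa]].
by apply: (cP a Aa); split=> // _ ->.
Qed.

(** * Scott power spaces *)

(** Principal lower sets are Scott closed. *)
Lemma scott_space_kolmogorov d (P : porderType d) :
  kolmogorov_space (scott_space P).
Proof.
have o (y : P) : @open (scott_space P) [set z : P | ~ (z <= y)%O].
  split=> [a b na ab|D s dD [_ slub] ns].
    by move=> b_y; apply: na; exact: le_trans b_y.
  apply: contrapT => nD; apply: ns; apply: slub => a Da.
  by apply: contrapT => na; apply: nD; exists a.
have key (x y : scott_space P) : ~ ((x : P) <= y)%O ->
    exists A : set (scott_space P), A \in nbhs x /\ y \in ~` A.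
  move=> nxy; exists [set z : P | ~ (z <= y)%O]; split; apply: mem_set.
    by apply: open_nbhs_nbhs; split=> //; exact: o.
  by apply; exact: lexx.
move=> x y /eqP xy.
have [xley|/key[A AP]] := pselect ((x : P) <= y)%O; last by exists A; left.
have [ylex|/key[A AP]] := pselect ((y : P) <= x)%O; last by exists A; right.
by case: xy; apply: le_anti; rewrite xley.
Qed.

Section scott_power_space.
Variable X : topologicalType.
Hypothesis wfX : well_filtered X.
Implicit Types (K L N S : compact_sat X) (D : set (compact_sat X)).

Lemma smyth_leP K L : reflect ((L : set X) `<=` K) (K <= L)%O.
Proof. exact: asboolP. Qed.

(** In the Smyth order of a well-filtered space every directed set has a
    supremum, namely its intersection; nonemptiness is well-filteredness for
    the empty open set, and compactness is well-filteredness for the union of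
    an open cover. *)
Lemma directed_capE D : directed D -> exists2 S, isLub D S &
  S = \bigcap_(K in D) (K : set X) :> set X.
Proof.
move=> [D0 dD].
have fD : filtered_family D.
  split=> // K L DK DL; have [N [DN /smyth_leP KN /smyth_leP LN]] := dD _ _ DK DL.
  by exists N.
pose Q := \bigcap_(K in D) (K : set X).
have Q0 : Q !=set0.
  apply: contrapT => /nonemptyPn Q0.
  have [|K _ K0] := wfX.2 D set0 fD open0; first by rewrite -/Q Q0.
  by have [x /K0] := compact_sat_neq0 K.
have cQ : compact Q.
  apply/compact_relatively => I E f Ef Qf; have [_ fo _] := Ef.
  have [K DK Kf] := wfX.2 D _ fD (bigcup_open fo) Qf.
  have /compact_relatively/(_ _ _ _ Ef Kf)[i Ei Ki] := @compact_sat_compact _ K.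
  by exists i => // x Qx; apply: Ki; exact: Qx.
have sQ : saturated Q.
  apply/seteqP; split=> [|x Qx K DK]; first exact: sub_saturation.
  rewrite (compact_sat_saturated K) => U [oU KU]; apply: Qx; split=> //.
  by move=> y Qy; apply: KU; exact: Qy.
exists (CompactSat Q0 cQ sQ) => //; split=> [K DK|L Lub].
  by apply/smyth_leP => x; exact.
by apply/smyth_leP => x Lx K DK; move: x Lx; apply/smyth_leP/Lub.
Qed.

Lemma directed_lub_cap D S : directed D -> isLub D S ->
  S = \bigcap_(K in D) (K : set X) :> set X.
Proof.
move=> dD [Sub Slub]; have [T [Tub Tlub] <-] := directed_capE dD.
by congr compact_sat_set; apply: le_anti; rewrite Slub ?Tlub.
Qed.

(** The Scott topology refines the upper Vietoris topology. *)
Lemma scott_open_box (U : set X) : open U ->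
  @open (scott_power_space X) [set K | (K : set X) `<=` U].
Proof.
move=> oU; split=> [K L KU /smyth_leP LK|D S dD DS SU].
  exact: subset_trans KU.
have [D0 fD] := dD.
have [||K DK KU] := wfX.2 D U _ oU.
- split=> // K L DK DL; have [N [DN /smyth_leP KN /smyth_leP LN]] := fD _ _ DK DL.
  by exists N.
- by rewrite -(directed_lub_cap dD DS).
- by exists K.
Qed.

Lemma scott_open_nmem (x : X) :
  @open (scott_power_space X) [set K | ~ (K : set X) x].
Proof.
split=> [K L nK /smyth_leP LK /LK//|D S dD DS].
rewrite /= (directed_lub_cap dD DS) => nS; apply: contrapT => nD; apply: nS.
by move=> K DK; apply: contrapT => nK; apply: nD; exists K.
Qed.

(** Each L in A `&` C is compact, hence inside one member f i of a directed open
    cover of the union; so the sets of all K inside f i, together with the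
    complement of C, form a directed open cover of A. *)
Lemma compact_bigcup_compact (A C : set (scott_power_space X)) :
  compact A -> closed C -> compact (\bigcup_(L in A `&` C) (L : set X)).
Proof.
move=> /compact_relatively cA cC; apply/compact_relatively => I D f Df Af.
have [D0 fo fD] := Df.
have [||i Di Ai] :=
    cA I D (fun i => [set K : scott_power_space X | (K : set X) `<=` f i] `|` ~` C).
- split=> // [i Di|i j Di Dj].
    by apply: openU; [exact: scott_open_box (fo _ Di)|exact: closed_openC].
  have [k [Dk ik jk]] := fD _ _ Di Dj.
  by exists k; split=> // K [Kf|nK]; by [right|left; exact: subset_trans Kf _].
- move=> L AL; have [CL|nCL] := pselect (C L); last first.
    by have [i Di] := D0; exists i => //; right.
  have [|i Di Li] := (compact_relatively _).1 (@compact_sat_compact _ L) _ _ _ Df.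
    by move=> x Lx; apply: Af; exists L.
  by exists i => //; left.
exists i => // x [L [AL CL] Lx]; by have [/(_ x Lx)|] := Ai L AL.
Qed.

(** Here M is the complement of the minimal closed set C and B Q is the union of
    the members of Q lying in C.  The intersection S of all B Q belongs to C
    and is above every element of C, so it belongs to every Q. *)
Lemma scott_power_space_well_filtered : well_filtered (scott_power_space X).
Proof.
split=> [|F U [[F0 FF0] fF] oU FU]; first exact: scott_space_kolmogorov.
apply: contrapT => nF.
have [S [Q FQ <-]|//|S [Q FQ <-] QU|M [oM UM FM Mmax]] :=
  @rudin_maximal_open _ [set (Q : set (scott_power_space X)) | Q in F] U.
- exists Q; first by exists Q.
  exact/compact_relatively/compact_sat_compact.
- by apply: nF; exists Q.
have QM Q : F Q -> exists2 N : compact_sat X, (Q : set _) N & ~ M N.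
  move=> FQ; apply: contrapT => H; apply: (FM Q); first by exists Q.
  by move=> N QN; apply: contrapT => nM; apply: H; exists N.
pose B (Q : compact_sat (scott_power_space X)) :=
  \bigcup_(L in (Q : set (scott_power_space X)) `&` ~` M) (L : set X).
have BP Q : F Q -> exists L : compact_sat X, L = B Q :> set X.
  move=> FQ; have B0 : B Q !=set0.
    have [N QN nMN] := QM _ FQ; have [x Nx] := compact_sat_neq0 N.
    by exists x, N => //; split.
  have cB : compact (B Q).
    apply: compact_bigcup_compact; last exact: open_closedC.
    exact: compact_sat_compact.
  have sB : saturated (B Q).
    by apply: saturated_bigcup => L _; exact: compact_sat_saturated.
  by exists (CompactSat B0 cB sB).
pose D := [set L : compact_sat X | exists2 Q, F Q & L = B Q :> set X].
have dD : directed D.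
  split; first by have [L LB] := BP _ FF0; exists L, F0.
  move=> L L' [Q FQ LQ] [Q' FQ' LQ'].
  have [Q'' [FQ'' QQ'' Q'Q'']] := fF _ _ FQ FQ'; have [L'' LB''] := BP _ FQ''.
  exists L''; split; first by exists Q''.
  - apply/smyth_leP; rewrite LB'' LQ => x [N [QN nMN] Nx].
    by exists N => //; split=> //; exact: QQ''.
  - apply/smyth_leP; rewrite LB'' LQ' => x [N [QN nMN] Nx].
    by exists N => //; split=> //; exact: Q'Q''.
have [S lubS SD] := directed_capE dD.
have nMS : ~ M S.
  move=> MS; have [L [[Q FQ LQ] ML]] := oM.2 D S dD lubS MS.
  have [N QN nMN] := QM _ FQ; apply/nMN/(oM.1 L) => //.
  by apply/smyth_leP => x Nx; rewrite LQ; exists N.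
(* A point x of S outside L would make the K avoiding x an open set not inside
   M; maximality of M then puts every element of some Q outside M among them,
   although x lies in B Q. *)
have MleS (L : compact_sat X) : ~ M L -> (L <= S)%O.
  move=> nML; apply/smyth_leP => x; rewrite SD => Sx; apply: contrapT => nLx.
  have [|_ [Q FQ <-] QMx] := Mmax _ (scott_open_nmem x); first by move=> /(_ L nLx).
  have [L' LB'] := BP _ FQ.
  have : (L' : set X) x by apply: Sx; exists Q.
  by rewrite LB' => -[N [QN nMN] Nx]; have [] := QMx N QN.
apply/nMS/UM/FU => Q FQ; have [N QN nMN] := QM _ FQ.
rewrite (compact_sat_saturated Q) => V [oV QV].
exact: oV.1 (QV _ QN) (MleS _ nMN).
Qed.

End scott_power_space.

Theorem corollary8p1 (X : topologicalType) (hX : well_filtered X)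
  (hK : first_countable (scott_power_space X)
        \/ core_compact (scott_power_space X)
        \/ locally_compact_space (scott_power_space X)) :
  sober (scott_power_space X).
Proof.
have wfK := scott_power_space_well_filtered hX.
case: hK => [fc|[cc|lc]].
- exact: first_countable_well_filtered_sober wfK fc.
- apply: (locally_compact_well_filtered_sober wfK).
  exact: core_compact_locally_compact wfK cc.
- exact: locally_compact_well_filtered_sober wfK lc.
Qed.
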